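(* Let $d\ge2$, let $K$ be a field, let $H\in\mathcal N_d$ with extremal rays $\mathbf a_1,\dots,\mathbf a_d$, let $R=K[H]$ with graded maximal ideal $\mathfrak m$, let $J=(\mathbf x^{\mathbf a_i}-\mathbf x^{\mathbf a_j}: i,j=1,\dots,d)R$, and let $0\ne\mathbf b\in\omega_H$. Then the following statements are equivalent: (i) there exists an integer $k\ge 0$ such that $\mathfrak m^{k+1}=J\mathfrak m^k$ modulo the ideal $\mathbf x^{\mathbf b}R$, i.e. $\mathfrak m^{k+1}+\mathbf x^{\mathbf b}R=J\mathfrak m^k+\mathbf x^{\mathbf b}R$; (ii) $\sum_{j=1}^d[\mathbf c]_j\ge 1$ for every $\mathbf c\in B_H\setminus\omega_H$.
   Context: $\mathbb N=\{0,1,2,\dots\}$. An affine semigroup $H\subseteq\mathbb N^d$ is a finitely generated submonoid of $\mathbb N^d$; it is always assumed that the group generated by $H$ is $\mathbb Z^d$. Let $C\subseteq\mathbb R^d$ be the cone generated by $H$. $H$ is normal if $H=C\cap\mathbb Z^d$, and simplicial if $C$ has exactly $d$ extremal rays (one-dimensional faces). $\mathcal N_d$ is the class of normal simplicial affine semigroups in $\mathbb N^d$ generating $\mathbb Z^d$ as a group. For $H\in\mathcal N_d$, the extremal rays of $H$ are the primitive lattice vectors $\mathbf a_1,\dots,\mathbf a_d\in H$ lying on the extremal rays of $C$; they form an $\mathbb R$-basis of $\mathbb R^d$. For $\mathbf z=\sum_i\lambda_i\mathbf a_i$ put $[\mathbf z]_i=\lambda_i$. $B_H$ (the Hilbert basis)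 is the unique minimal generating set of $H$, and $\omega_H=\mathbb Z^d\cap\operatorname{relint}C=\{\mathbf h\in\mathbb Z^d:[\mathbf h]_i>0\text{ for all }i\}$. $K[H]$ is the subalgebra of $K[x_1,\dots,x_d]$ spanned by the monomials $\mathbf x^{\mathbf h}$, $\mathbf h\in H$; its graded maximal ideal $\mathfrak m$ is generated by $\mathbf x^{\mathbf h}$, $0\ne\mathbf h\in H$. *)

(* Defs.v *)
From HB Require Import structures.
From mathcomp Require Import all_boot all_order all_algebra.
From mathcomp Require Import boolp classical_sets functions cardinality reals.
From mathcomp Require Import mpoly.

Set Implicit Arguments.
Unset Strict Implicit.
Unset Printing Implicit Defensive.

Import Order.TTheory GRing.Theory Num.Theory.

Local Open Scope ring_scope.
Local Open Scope classical_set_scope.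
Local Open Scope card_scope.

(* N^d is the type 'X_{1..d} of monomials, Z^d is 'rV[int]_d and R^d is
   'rV[R]_d for R : realType. *)

Definition nat_to_int_vec (d : nat) (h : 'X_{1..d}) : 'rV[int]_d :=
  \row_i (h i)%:Z.

Definition int_to_real_vec (R : realType) (d : nat) (z : 'rV[int]_d) :
  'rV[R]_d := map_mx intr z.

Definition nat_to_real_vec (R : realType) (d : nat) (h : 'X_{1..d}) :
  'rV[R]_d := int_to_real_vec R (nat_to_int_vec h).

Section ConvexGeometry.
Variables (R : realType) (d : nat).
Implicit Types (A C F : set 'rV[R]_d).

Definition cone A : set 'rV[R]_d :=
  [set v | exists s : seq (R * 'rV[R]_d),
    (forall p, p \in s -> 0 <= p.1 /\ A p.2) /\
    v = \sum_(p <- s) p.1 *: p.2].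

Definition affine_hull A : set 'rV[R]_d :=
  [set v | exists s : seq (R * 'rV[R]_d),
    [/\ forall p, p \in s -> A p.2,
        \sum_(p <- s) p.1 = 1
      & v = \sum_(p <- s) p.1 *: p.2]].

Definition relint C : set 'rV[R]_d :=
  [set x | C x /\ exists2 e : R, 0 < e &
    forall y, affine_hull C y -> (forall i, `|y 0 i - x 0 i| < e) -> C y].

Definition convex C : Prop :=
  forall x y (t : R), C x -> C y -> 0 <= t <= 1 -> C ((1 - t) *: x + t *: y).

Definition face C F : Prop :=
  [/\ F `<=` C, convex F
    & forall x y (t : R), C x -> C y -> 0 < t < 1 ->
        F ((1 - t) *: x + t *: y) -> F x /\ F y].

(* A nonempty face of a cone contains 0, so its affine hull is its linear
   span, and it has dimension one iff that span is a line. *)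
Definition extremal_ray C F : Prop :=
  face C F /\
  exists2 v, F v /\ v != 0 & forall w, F w -> exists t : R, w = t *: v.

End ConvexGeometry.

Section AffineSemigroups.
Variable d : nat.
Implicit Types (H S : set 'X_{1..d}).

Definition is_submonoid H : Prop :=
  H 0%MM /\ forall m n, H m -> H n -> H (m + n)%MM.

Definition generates S H : Prop := smallest is_submonoid S = H.

Definition minimal_generating_set H S : Prop :=
  generates S H /\ forall S', S' `<=` S -> generates S' H -> S' = S.

Definition is_subgroup (G : set 'rV[int]_d) : Prop :=
  G 0 /\ forall x y, G x -> G y -> G (x - y).

Definition affine_semigroup H : Prop :=
  [/\ is_submonoid H,
      exists2 S, finite_set S & generates S H
    & smallest is_subgroup (@nat_to_int_vec d @` H) = setT].

Variable R : realType.

Definition real_cone H : set 'rV[R]_d := cone (@nat_to_real_vec R d @` H).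

Definition normal_semigroup H : Prop :=
  @nat_to_int_vec d @` H = [set z | real_cone H (int_to_real_vec R z)].

Definition simplicial_semigroup H : Prop :=
  [set F | extremal_ray (real_cone H) F] #= `I_d.

Definition normal_simplicial H : Prop :=
  [/\ affine_semigroup H, normal_semigroup H & simplicial_semigroup H].

Definition primitive (v : 'X_{1..d}) : Prop :=
  \big[gcdn/0%N]_(i < d) v i = 1%N.

Definition extremal_rays H (a : 'I_d -> 'X_{1..d}) : Prop :=
  injective a /\
  range a = [set v | [/\ H v, primitive v
    & exists2 F, extremal_ray (real_cone H) F & F (nat_to_real_vec R v)]].

Definition ray_coord (a : 'I_d -> 'X_{1..d}) (j : 'I_d) (z : 'rV[int]_d) : R :=
  coord [tuple nat_to_real_vec R (a i) | i < d] j (int_to_real_vec R z).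

Definition omega H : set 'rV[int]_d :=
  [set z | relint (real_cone H) (int_to_real_vec R z)].

End AffineSemigroups.

Section Ideals.
Variables (A : comNzRingType) (B : set A).
Implicit Types (G I J : set A).

Definition ideal_span G : set A :=
  [set x | exists s : seq (A * A),
    (forall p, p \in s -> B p.1 /\ G p.2) /\ x = \sum_(p <- s) p.1 * p.2].

Definition ideal_add I J : set A := [set x + y | x in I & y in J].

Definition ideal_mul I J : set A := ideal_span [set x * y | x in I & y in J].

Definition ideal_exp I (k : nat) : set A := iter k (ideal_mul I) B.

End Ideals.

Section SemigroupAlgebra.
Variables (K : fieldType) (d : nat) (H : set 'X_{1..d}).

Definition semigroup_algebra : set {mpoly K[d]} :=
  [set p | forall m, m \in msupp p -> H m].

Definition max_ideal : set {mpoly K[d]} :=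
  ideal_span semigroup_algebra
    [set 'X_[h] | h in [set h | H h /\ h != 0%MM]].

Definition ray_difference_ideal (a : 'I_d -> 'X_{1..d}) : set {mpoly K[d]} :=
  ideal_span semigroup_algebra
    [set p | exists i j, p = 'X_[a i] - 'X_[a j]].

Definition monomial_ideal (b : 'X_{1..d}) : set {mpoly K[d]} :=
  ideal_span semigroup_algebra [set 'X_[b]].

End SemigroupAlgebra.

Arguments semigroup_algebra K {d} H.
Arguments max_ideal K {d} H.
Arguments ray_difference_ideal K {d} H a.
Arguments monomial_ideal K {d} H b.

(* Main.v *)
(* Write e(h) for the vector of barycentric coordinates ([h]_j)_j of h in H,
   scaled by a common denominator D = |det(a_1, ..., a_d)| to be integral. As C is
   the cone over the a_j, normality says that h - g is in H iff e(g) <= e(h).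

   All powers of the maximal ideal are monomial, m^k being spanned by the sums of
   at least k generators. If c lies on a facet [.]_j = 0, then (i) forces every
   h + c, with h on the facet and x^h in m^k, to be a_i + u with u of the same kind:
   b is off the facet, and J m^k is supported in the union of the a_i + u.
   Iterating from h = kc gives (k + n) sum_j [c]_j >= n for all n, hence (ii).

   Conversely, in a long sum of generators either an interior generator is repeated
   so often that the sum lies in b + H, or D copies of a generator c on the boundary
   can be replaced by D c = sum_j e_j(c) a_j, which by (ii) is at least as long.
   So almost all summands may be taken to be rays; these are interchangeable
   modulo J m^k, and spreading them evenly over all a_j lands in b + H. *)

Require Import Defs.
From HB Require Import structures.
From mathcomp Require Import all_boot all_order all_algebra.
From mathcomp Require Import boolp classical_sets functions cardinality reals.
From mathcomp Require Import mpoly zify.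

Set Implicit Arguments.
Unset Strict Implicit.
Unset Printing Implicit Defensive.

Import Order.TTheory GRing.Theory Num.Theory.

Local Open Scope ring_scope.
Local Open Scope classical_set_scope.

(** * Monomial ideals of the semigroup algebra *)

Section IdealSpan.
Variables (A : comNzRingType) (B : set A).

Lemma ideal_span0 (G : set A) : ideal_span B G 0.
Proof. by exists [::]; split=> //; rewrite big_nil. Qed.

Lemma ideal_spanD (G : set A) x y :
  ideal_span B G x -> ideal_span B G y -> ideal_span B G (x + y).
Proof.
move=> [s [sG ->]] [t [tG ->]]; exists (s ++ t); split; last by rewrite big_cat.
by move=> p; rewrite mem_cat => /orP[/sG|/tG].
Qed.

Lemma ideal_span_gen (G : set A) x y : B x -> G y -> ideal_span B G (x * y).
Proof.
move=> Bx Gy; exists [:: (x, y)]; split; last by rewrite big_seq1.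
by move=> p; rewrite inE => /eqP->.
Qed.

Lemma ideal_span_mull (G : set A) c x : (forall y z, B y -> B z -> B (y * z)) ->
  B c -> ideal_span B G x -> ideal_span B G (c * x).
Proof.
move=> BM Bc [s [sG ->]]; exists [seq (c * p.1, p.2) | p <- s]; split.
  by move=> _ /mapP[p /sG[Bp Gp] ->] /=; split=> //; apply: BM.
by rewrite big_map mulr_sumr; apply: eq_bigr => p _; rewrite mulrA.
Qed.

Lemma ideal_span_subset (G P : set A) : P 0 ->
  (forall x y, P x -> P y -> P (x + y)) -> (forall x y, B x -> G y -> P (x * y)) ->
  ideal_span B G `<=` P.
Proof.
move=> P0 PD BG _ [s [sG ->]]; rewrite big_seq.
by apply: (big_ind P) => // p /sG[]; apply: BG.
Qed.

End IdealSpan.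

(** * Polynomials supported in a given set of monomials *)

Section MonomialSupport.
Variables (K : fieldType) (d : nat).
Implicit Types (P Q S : set 'X_{1..d}) (p q : {mpoly K[d]}).

Notation supported := (@semigroup_algebra K d).

Lemma supported0 P : supported P 0.
Proof. by move=> m; rewrite mcoeff_msupp mcoeff0 eqxx. Qed.

Lemma supportedD P p q : supported P p -> supported P q -> supported P (p + q).
Proof. by move=> Pp Pq m /msuppD_le; rewrite mem_cat => /orP[/Pp|/Pq]. Qed.

Lemma supportedM P Q S p q : (forall m n, P m -> Q n -> S (m + n)%MM) ->
  supported P p -> supported Q q -> supported S (p * q).
Proof. by move=> PQ Pp Qq _ /msuppM_le/allpairsP[[m n] [/Pp ? /Qq ? ->]]; apply: PQ. Qed.

Lemma supportedB P p q : supported P p -> supported P q -> supported P (p - q).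
Proof. by move=> Pp Pq m /msuppB_le; rewrite mem_cat => /orP[/Pp|/Pq]. Qed.

Lemma supportedX P m : P m -> supported P 'X_[m].
Proof. by move=> Pm _ /mem_msuppXP <-. Qed.

Lemma supportedC P c : P 0%MM -> supported P c%:MP.
Proof. by move=> P0 m; rewrite msuppC; case: eqP => // _; rewrite inE => /eqP->. Qed.

Lemma supported_ind P (Q : set {mpoly K[d]}) : Q 0 ->
  (forall p q, Q p -> Q q -> Q (p + q)) -> (forall c m, P m -> Q (c%:MP * 'X_[m])) ->
  supported P `<=` Q.
Proof.
move=> Q0 QD QX p Pp; rewrite [p]mpolyE big_seq; apply: (big_ind Q) => // m /Pp Pm.
by rewrite -mul_mpolyC; apply: QX.
Qed.

End MonomialSupport.

(** * Monomial ideals and the powers of the maximal ideal *)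

Section MonomialIdeals.
Variables (K : fieldType) (d : nat) (H : set 'X_{1..d}).
Hypothesis H_monoid : is_submonoid H.

Notation supported := (@semigroup_algebra K d).

Let H0 : H 0%MM. Proof. by case: H_monoid. Qed.
Let HD m n : H m -> H n -> H (m + n)%MM. Proof. by case: H_monoid => _; apply. Qed.

Lemma semigroup_algebraM p q : supported H p -> supported H q -> supported H (p * q).
Proof. exact: (supportedM HD). Qed.

(** Turns ideal identities into statements about sets of exponents. The generators need not be
    monomials, so that products of two arbitrary elements of monomial ideals are covered as well. *)
Lemma ideal_span_supported (G : set {mpoly K[d]}) (P : set 'X_{1..d}) :
  (forall h m, H h -> P m -> P (h + m)%MM) -> G `<=` supported P ->
  (forall m, P m -> exists h g, [/\ H h, G g & 'X_[m] = 'X_[h] * g]) ->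
  ideal_span (supported H) G = supported P.
Proof.
move=> HP GP PG; apply/seteqP; split.
  apply: ideal_span_subset; [exact: supported0|exact: supportedD|].
  by move=> x y Hx /GP; apply: (supportedM HP).
apply: supported_ind; [exact: ideal_span0|exact: ideal_spanD|].
move=> c m /PG[h [g [Hh Gg ->]]]; rewrite mulrA; apply: ideal_span_gen => //.
by apply: semigroup_algebraM; [exact: supportedC|exact: supportedX].
Qed.

Lemma ideal_mul_supported (P Q S : set 'X_{1..d}) :
  (forall h m, H h -> S m -> S (h + m)%MM) ->
  (forall m n, P m -> Q n -> S (m + n)%MM) ->
  (forall m, S m -> exists p q, [/\ P p, Q q & m = (p + q)%MM]) ->
  ideal_mul (supported H) (supported P) (supported Q) = supported S.
Proof.
move=> HS PQ SPQ; apply: ideal_span_supported => //.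
  by move=> _ [x Px [y Qy <-]]; apply: (supportedM PQ).
move=> m /SPQ[p [q [Pp Qq ->]]]; exists 0%MM, ('X_[p] * 'X_[q]); split=> //.
  by exists 'X_[p]; [exact: supportedX|exists 'X_[q] => //; exact: supportedX].
by rewrite mpolyX0 mul1r mpolyXD.
Qed.

Lemma monomial_idealE b :
  H b -> monomial_ideal K H b = supported [set (h + b)%MM | h in H].
Proof.
move=> Hb; apply: ideal_span_supported.
- move=> h _ Hh [g Hg <-]; exists (h + g)%MM; first exact: HD.
  by rewrite addmA.
- by move=> _ ->; apply: supportedX; exists 0%MM => //; rewrite add0m.
- by move=> _ [h Hh <-]; exists h, 'X_[b]; split=> //; rewrite mpolyXD.
Qed.

(* At least k rather than exactly k summands: this is upward closed under H when
   G generates H. *)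
Definition long_sums (G : seq 'X_{1..d}) (k : nat) : set 'X_{1..d} :=
  [set m | exists s : seq 'X_{1..d},
    [/\ {subset s <= G}, (k <= size s)%N & m = (\sum_(x <- s) x)%MM]].

Variable G : seq 'X_{1..d}.
Hypothesis G0 : 0%MM \notin G.
Hypothesis HG : H = long_sums G 0.

Lemma long_sumsD k l m n :
  long_sums G k m -> long_sums G l n -> long_sums G (k + l) (m + n)%MM.
Proof.
move=> [s [sG ks ->]] [t [tG lt ->]]; exists (s ++ t); split.
- by move=> x; rewrite mem_cat => /orP[/sG|/tG].
- by rewrite size_cat leq_add.
- by rewrite big_cat.
Qed.

Lemma long_sums_split k l m : long_sums G (k + l) m ->
  exists p q, [/\ long_sums G k p, long_sums G l q & m = (p + q)%MM].
Proof.
move=> [s [sG ks ->]].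
exists (\sum_(x <- take k s) x)%MM, (\sum_(x <- drop k s) x)%MM; split.
- exists (take k s); split=> // [x /mem_take/sG //|].
  by rewrite size_take_min leq_min leqnn (leq_trans (leq_addr l k) ks).
- exists (drop k s); split=> // [x /mem_drop/sG //|].
  by rewrite size_drop leq_subRL ?(leq_trans (leq_addr l k) ks).
- by rewrite -big_cat cat_take_drop.
Qed.

Lemma long_sumsW k l m : (k <= l)%N -> long_sums G l m -> long_sums G k m.
Proof. by move=> kl [s [sG ls ->]]; exists s; split=> //; apply: leq_trans ls. Qed.

Lemma long_sums_up k h m : H h -> long_sums G k m -> long_sums G k (h + m)%MM.
Proof. by rewrite HG -{2}[k]add0n; apply: long_sumsD. Qed.

Lemma long_sums1 m : H m -> m != 0%MM -> long_sums G 1 m.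
Proof.
rewrite HG => -[[|x s] [sG _ ->]]; first by rewrite big_nil eqxx.
by exists (x :: s).
Qed.

(** Exponents in N^d cannot cancel, so one nonzero summand keeps the sum nonzero. *)
Lemma long_sums1_neq0 m : long_sums G 1 m -> m != 0%MM.
Proof.
move=> [[|x s] [sG // _ ->]]; rewrite big_cons mnmD_eq0 negb_and.
by apply/orP; left; apply: contraNneq G0 => <-; apply: sG; rewrite mem_head.
Qed.

Lemma long_sumsH k m : long_sums G k m -> H m.
Proof. by rewrite HG; apply: long_sumsW. Qed.

Lemma max_idealE : max_ideal K H = supported (long_sums G 1).
Proof.
apply: ideal_span_supported => [h m|_ [m [Hm m0] <-]|m Gm]; first exact: long_sums_up.
  by apply: supportedX; apply: long_sums1.
exists 0%MM, 'X_[m]; split=> //; last by rewrite mpolyX0 mul1r.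
by exists m => //; split; [exact: (long_sumsH Gm)|exact: long_sums1_neq0].
Qed.

Lemma ideal_exp_max k :
  ideal_exp (supported H) (max_ideal K H) k = supported (long_sums G k).
Proof.
elim: k => [|k IH]; first by rewrite {1}HG.
rewrite /ideal_exp iterS -/(ideal_exp _ _ _) IH max_idealE.
apply: ideal_mul_supported => [h m|m n|m]; first exact: long_sums_up.
  exact: long_sumsD.
exact: (@long_sums_split 1 k).
Qed.

Lemma long_sums_big (I : Type) (f : I -> 'X_{1..d}) (u : seq I) :
  (forall i, long_sums G 1 (f i)) -> long_sums G (size u) (\sum_(i <- u) f i)%MM.
Proof.
move=> Gf; elim: u => [|i u IH]; first by exists [::]; split=> //; rewrite !big_nil.
by rewrite big_cons; apply: (long_sumsD (Gf i) IH).
Qed.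

(** * Products with the ray difference ideal *)

Section Reduction.
Variables (a : 'I_d -> 'X_{1..d}) (b : 'X_{1..d}).
Hypothesis Ha : forall i, long_sums G 1 (a i).
Hypothesis Hb : H b.

Let m := max_ideal K H.
Let J := ray_difference_ideal K H a.

Lemma ray_difference_subset : J `<=` m.
Proof.
rewrite /m max_idealE; apply: ideal_span_subset.
- exact: supported0.
- exact: supportedD.
- move=> x y Hx [i [j ->]]; apply: (supportedM (@long_sums_up 1) Hx).
  by apply: supportedB; apply: supportedX.
Qed.

Lemma ideal_mul_subset k :
  ideal_mul (supported H) J (ideal_exp (supported H) m k) `<=`
  ideal_exp (supported H) m k.+1.
Proof.
move=> _ [s [sG ->]]; exists s; split=> // p /sG[Hp [x Jx [y my xy]]].
by split=> //; exists x; [exact: ray_difference_subset|exists y].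
Qed.

(** Only an inclusion, since [J] is not monomial: both terms of each generator of [J] are ray
    monomials, so every exponent in [J] is a ray plus an element of [H]. *)
Lemma ideal_mul_support k :
  ideal_mul (supported H) J (ideal_exp (supported H) m k) `<=`
  supported [set h | exists i u, long_sums G k u /\ h = (a i + u)%MM].
Proof.
rewrite /m ideal_exp_max; apply: ideal_span_subset.
- exact: supported0.
- exact: supportedD.
move=> z _ Hz [x Jx [y my <-]].
have {Jx}Jx : supported [set h | exists i u, H u /\ h = (a i + u)%MM] x.
  have ray w i : supported H w ->
      supported [set h | exists i u, H u /\ h = (a i + u)%MM] (w * 'X_[a i]).
    move=> Hw; apply: (supportedM (Q := [set a i]) _ Hw); last exact: supportedX.
    by move=> h _ Hh ->; exists i, h; rewrite addmC.
  move: x Jx; apply: ideal_span_subset; [exact: supported0|exact: supportedD|].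
  by move=> x _ Hx [i [j ->]]; rewrite mulrBr; apply: supportedB; apply: ray.
apply: (supportedM _ Hz (supportedM (S := [set h | exists i u,
  long_sums G k u /\ h = (a i + u)%MM]) _ Jx my)).
  move=> h _ Hh [i [u [Gu ->]]]; exists i, (h + u)%MM.
  by split; [exact: long_sums_up|rewrite !addmA [(h + _)%MM]addmC].
move=> _ n [i [u [Hu ->]]] Gn; exists i, (u + n)%MM.
by split; [exact: long_sums_up|rewrite addmA].
Qed.

(** Telescoping: the rays of [u] are replaced one at a time, each exchange costing a multiple of
    some x^(a_i) - x^(a_j) whose cofactor still has at least [k] summands. Rays already exchanged
    move into [n], which is why [l] and [n] vary in the induction. *)
Lemma ray_exchange k l n (u v : seq 'I_d) : size u = size v ->
  (k < size u + l)%N -> long_sums G l n ->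
  ideal_mul (supported H) J (ideal_exp (supported H) m k)
    ('X_[\sum_(i <- u) a i + n] - 'X_[\sum_(i <- v) a i + n]).
Proof.
elim: u v l n => [|i u IH] [|j v] //= l n.
  by move=> _ _ _; rewrite !big_nil subrr; exact: ideal_span0.
move=> [uv] kul Gn; rewrite !big_cons.
have -> : 'X_[a i + \sum_(x <- u) a x + n] - 'X_[a j + \sum_(x <- v) a x + n] =
    1 * (('X_[a i] - 'X_[a j]) * 'X_[\sum_(x <- u) a x + n]) +
    ('X_[\sum_(x <- u) a x + (a j + n)] - 'X_[\sum_(x <- v) a x + (a j + n)])
    :> {mpoly K[d]}.
  by rewrite mul1r mulrBl -!mpolyXD !addmA ![(\sum_(_ <- _) _ + a j)%MM]addmC addrA subrK.
apply: ideal_spanD.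
  apply: ideal_span_gen; first by rewrite -(mpolyX0 d K); apply: supportedX.
  exists ('X_[a i] - 'X_[a j]).
    rewrite -[_ - _]mul1r; apply: ideal_span_gen; last by exists i, j.
    by rewrite -(mpolyX0 d K); apply: supportedX.
  eexists; last by [].
  rewrite /m ideal_exp_max; apply: supportedX.
  by apply: long_sumsW (long_sumsD (long_sums_big u Ha) Gn).
by apply: (IH v l.+1) => //; [rewrite addnS|exact: (long_sumsD (Ha j) Gn)].
Qed.

End Reduction.
End MonomialIdeals.

(** * Reductions modulo the interior monomial *)

Lemma perm_nseq_count (T : eqType) (c : T) n s :
  (n <= count_mem c s)%N -> exists t, perm_eq s (nseq n c ++ t).
Proof.
elim: n s => [|n IH] s; first by exists s.
move=> ns; have cs : c \in s by rewrite -has_pred1 has_count; apply: leq_trans ns.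
have [|t st] := IH (rem c s); first by rewrite count_rem cs /= eqxx; lia.
by exists t; apply: (perm_trans (perm_to_rem cs)); rewrite /= perm_cons.
Qed.

(** Pigeonhole, applied in contrapositive form: a long sum over [G] repeats some generator more than
    [L] times. *)
Lemma size_leq_counts (T : eqType) (G s : seq T) L :
  {subset s <= G} -> (forall c, c \in G -> (count_mem c s <= L)%N) ->
  (size s <= size G * L)%N.
Proof.
elim: G s => [|c G IH] s sG sL; first by
  case: s sG {sL} => // x s /(_ x); rewrite mem_head => /(_ isT).
rewrite -(count_predC (pred1 c) s) mulSn leq_add ?sL ?mem_head //.
rewrite -size_filter; apply: IH => [x|x xG].
  by rewrite mem_filter => /andP[/= /negbTE xc /sG]; rewrite inE xc.
apply: leq_trans (sL x _); last by rewrite inE xG orbT.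
by rewrite count_filter; apply: sub_count => y /andP[].
Qed.

Lemma exists_seq_count (T : finType) (f : T -> nat) :
  exists2 v : seq T, (forall j, count_mem j v = f j) & size v = (\sum_j f j)%N.
Proof.
exists (flatten [seq nseq (f i) i | i <- enum T]).
  move=> j; rewrite count_flatten -map_comp sumnE big_map big_enum /= (bigD1 j) //=.
  rewrite count_nseq /= eqxx mul1n big1 ?addn0 // => i /negbTE ij.
  by rewrite count_nseq /= ij.
rewrite size_flatten /shape -map_comp sumnE big_map big_enum /=.
by apply: eq_bigr => i _; rewrite size_nseq.
Qed.

(* The integers e h j are the barycentric coordinates [h]_j scaled by a common
   denominator D, so that normality of H becomes coordsB. *)
Record scaled_coords (d : nat) (H : set 'X_{1..d}) (a : 'I_d -> 'X_{1..d})
    (D : nat) (e : 'X_{1..d} -> 'I_d -> nat) : Prop := ScaledCoords {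
  coords_ray_mem : forall i, H (a i);
  coords_denom_gt0 : (0 < D)%N;
  coordsD : forall g h j, H g -> H h -> e (g + h)%MM j = (e g j + e h j)%N;
  coords_ray : forall i j, e (a i) j = (D * (i == j))%N;
  coordsB : forall g h, H g -> H h -> (forall j, (e g j <= e h j)%N) ->
    exists2 h', H h' & h = (h' + g)%MM }.

(** * Reductions in terms of scaled coordinates *)

Section Reductions.
Variables (K : fieldType) (d : nat) (H : set 'X_{1..d}) (G : seq 'X_{1..d}).
Variables (a : 'I_d -> 'X_{1..d}) (D : nat) (e : 'X_{1..d} -> 'I_d -> nat).
Hypothesis H_monoid : is_submonoid H.
Hypothesis G0 : 0%MM \notin G.
Hypothesis HG : H = long_sums G 0.
Hypothesis coords : scaled_coords H a D e.

Let D0 : (0 < D)%N. Proof. exact: (coords_denom_gt0 coords). Qed.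
Let eD := coordsD coords.
Let e_ray := coords_ray coords.

Lemma coords0 j : e 0%MM j = 0%N.
Proof. by have := eD j H_monoid.1 H_monoid.1; rewrite add0m; lia. Qed.

Lemma submonoid_sum (I : eqType) (f : I -> 'X_{1..d}) (s : seq I) :
  (forall i, i \in s -> H (f i)) -> H (\sum_(i <- s) f i)%MM.
Proof.
by move=> Hf; rewrite big_seq; apply: big_ind => //; [case: H_monoid|exact: H_monoid.2].
Qed.

Lemma coords_sum (I : eqType) (f : I -> 'X_{1..d}) (s : seq I) j :
  (forall i, i \in s -> H (f i)) ->
  e (\sum_(i <- s) f i)%MM j = (\sum_(i <- s) e (f i) j)%N.
Proof.
elim: s => [|i s IH] Hf; first by rewrite !big_nil coords0.
have Hs k : k \in s -> H (f k) by move=> ks; apply: Hf; rewrite inE ks orbT.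
rewrite !big_cons eD ?IH //; first by apply: Hf; rewrite mem_head.
exact: submonoid_sum.
Qed.

(** By [coordsB] each of [g] and [h] is a summand of the other, and N^d has no invertible element
    besides 0. *)
Lemma coords_inj g h : H g -> H h -> e g =1 e h -> g = h.
Proof.
move=> Hg Hh gh.
have [g' _ hg] : exists2 g', H g' & h = (g' + g)%MM.
  by apply: (coordsB coords) => // j; rewrite gh.
have [h' _ gh'] : exists2 h', H h' & g = (h' + h)%MM.
  by apply: (coordsB coords) => // j; rewrite gh.
apply/mnmP => i; move/mnmP/(_ i): hg; move/mnmP/(_ i): gh'.
by rewrite !mnmDE; lia.
Qed.

Lemma ray_neq0 i : a i != 0%MM.
Proof.
apply/eqP => ai0; have := e_ray i i; rewrite ai0 coords0 eqxx muln1.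
by move=> D00; move: D0; rewrite -D00.
Qed.

Lemma ray_long i : long_sums G 1 (a i).
Proof. by apply: (long_sums1 HG); [exact: (coords_ray_mem coords)|exact: ray_neq0]. Qed.

Lemma ray_sum_mem (u : seq 'I_d) : H (\sum_(i <- u) a i)%MM.
Proof. by apply: submonoid_sum => i _; exact: (coords_ray_mem coords). Qed.

Lemma coords_ray_sum (u : seq 'I_d) j :
  e (\sum_(i <- u) a i)%MM j = (D * count_mem j u)%N.
Proof.
rewrite coords_sum; last by move=> i _; exact: (coords_ray_mem coords).
rewrite -sum1_count big_distrr [RHS]big_mkcond /=.
by apply: eq_bigr => i _; rewrite e_ray; case: eqP => _; rewrite ?muln1 ?muln0.
Qed.

Lemma nseq_sum_mem n c : H c -> H (\sum_(x <- nseq n c) x)%MM.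
Proof. by move=> Hc; apply: submonoid_sum => i; rewrite mem_nseq => /andP[_ /eqP->]. Qed.

Lemma coords_nseq n c j : H c -> e (\sum_(x <- nseq n c) x)%MM j = (n * e c j)%N.
Proof.
move=> Hc; rewrite coords_sum; first by rewrite big_nseq iter_addn_0 mulnC.
by move=> i; rewrite mem_nseq => /andP[_ /eqP->].
Qed.

(** The relation D c = sum_j e_j(c) a_j: both sides have j-th coordinate D e_j(c). It trades [D]
    summands for sum_j e_j(c) rays. *)
Lemma coords_sum_rays c : H c -> exists2 u : seq 'I_d,
  size u = (\sum_j e c j)%N & (\sum_(x <- nseq D c) x)%MM = (\sum_(i <- u) a i)%MM.
Proof.
move=> Hc; have [u cu su] := exists_seq_count (e c); exists u => //.
apply: coords_inj => [||j]; [exact: nseq_sum_mem|exact: ray_sum_mem|].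
by rewrite coords_nseq // coords_ray_sum cu.
Qed.

Lemma generator_mem c : c \in G -> H c.
Proof.
rewrite HG => cG; exists [:: c]; split=> //; last by rewrite big_seq1.
by move=> x; rewrite inE => /eqP->.
Qed.

Variable b : 'X_{1..d}.
Hypothesis Hb : H b.

Let m := max_ideal K H.
Let J := ray_difference_ideal K H a.

(** As long as more than |G| L non-ray summands remain, some [c] occurs more than [L] times. If [c]
    is interior, [L] copies already dominate [b]; otherwise [D] copies are traded for at least [D]
    rays, so the total number of summands does not drop. *)
Lemma split_off_rays k L h : (D <= L)%N -> (forall j, (e b j <= L)%N) ->
  (forall c, c \in G -> (forall j, (0 < e c j)%N) \/ (D <= \sum_j e c j)%N) ->
  long_sums G k h -> (exists2 h', H h' & h = (h' + b)%MM) \/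
    exists u s, [/\ {subset s <= G}, (size s <= size G * L)%N,
      (k <= size u + size s)%N & h = (\sum_(i <- u) a i + \sum_(x <- s) x)%MM].
Proof.
move=> DL bL Glarge [s [sG ks hs]].
pose u : seq 'I_d := [::].
have {hs} : h = (\sum_(i <- u) a i + \sum_(x <- s) x)%MM by rewrite big_nil add0m.
have {ks} : (k <= size u + size s)%N by [].
(* The induction is on the number of summands not yet traded; each trade lowers it by [D], which is
   positive. *)
have [n] := ubnP (size s); elim: n s u sG => // n IH s u sG sn ks hs.
have [sL|sL] := leqP (size s) (size G * L); first by right; exists u, s.
have [c cG cs] : exists2 c, c \in G & (L < count_mem c s)%N.
  apply: contrapT => ncs; move: sL; rewrite ltnNge => /negP; apply.
  apply: size_leq_counts => // c cG; rewrite leqNgt; apply/negP => cs.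
  by apply: ncs; exists c.
have Hc := generator_mem cG.
case: (Glarge c cG) => [c0|Dc].
  have [t st] := perm_nseq_count (ltnW cs); left.
  have Ht : H (\sum_(x <- t) x)%MM.
    apply: submonoid_sum => x xt; apply/generator_mem/sG.
    by rewrite (perm_mem st) mem_cat xt orbT.
  have HL := nseq_sum_mem L Hc; have Hu := ray_sum_mem u.
  rewrite {}hs (perm_big _ st) big_cat /=; apply: (coordsB coords) => //.
    by apply: H_monoid.2 => //; apply: H_monoid.2.
  move=> j; rewrite !eD //; last by apply: H_monoid.2.
  rewrite coords_nseq //; apply: leq_trans (bL j) _.
  by have := leq_pmulr L (c0 j); lia.
have [t st] := perm_nseq_count (leq_trans DL (ltnW cs)).
have [v sv cv] := coords_sum_rays Hc.
have size_st : size s = (D + size t)%N by rewrite (perm_size st) size_cat size_nseq.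
apply: (IH t (v ++ u)).
- by move=> x xt; apply: sG; rewrite (perm_mem st) mem_cat xt orbT.
- by rewrite ltnS in sn; apply: leq_trans sn; rewrite size_st -[X in (X < _)%N]add0n ltn_add2r.
- by rewrite size_cat sv (leq_trans ks) // size_st addnCA -addnA leq_add2r.
- by rewrite hs (perm_big _ st) !big_cat /= cv addmA [(\sum_(i <- u) _ + _)%MM]addmC.
Qed.

Lemma reduction_of_large_weights :
  (0 < d)%N ->
  (forall c, c \in G -> (forall j, (0 < e c j)%N) \/ (D <= \sum_j e c j)%N) ->
  exists k, ideal_add (ideal_exp (semigroup_algebra K H) m k.+1) (monomial_ideal K H b) =
    ideal_add (ideal_mul (semigroup_algebra K H) J
      (ideal_exp (semigroup_algebra K H) m k)) (monomial_ideal K H b).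
Proof.
move=> d0 Glarge; pose L := (D + \sum_j e b j)%N.
have DL : (D <= L)%N by rewrite leq_addr.
have bL j : (e b j <= L)%N by rewrite /L (bigD1 j) //= addnCA leq_addr.
(* At most |G| L summands are left untraded, so at least d L rays are available: [L] for each of the
   [d] rays. *)
pose k := (size G * L + d * L)%N; exists k.
have xb0 : monomial_ideal K H b 0 by exact: ideal_span0.
apply/seteqP; split=> _ [x xm [y yb <-]]; last first.
  by exists x; [apply: (ideal_mul_subset H_monoid G0 HG ray_long)|exists y].
suff {y yb} : ideal_add (ideal_mul (semigroup_algebra K H) J
      (ideal_exp (semigroup_algebra K H) m k)) (monomial_ideal K H b) x.
  move=> [x1 Jx1 [x2 bx2 <-]]; exists x1 => //; exists (x2 + y); last by rewrite addrA.
  exact: ideal_spanD.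
move: x xm; rewrite {1}/m (ideal_exp_max K H_monoid G0 HG).
have constC c : semigroup_algebra K H c%:MP by apply: supportedC; case: H_monoid.
apply: supported_ind => [|p q|c h hk].
- by exists 0; [exact: ideal_span0|exists 0; [exact: xb0|rewrite addr0]].
- move=> [p1 Jp1 [p2 bp2 <-]] [q1 Jq1 [q2 bq2 <-]].
  exists (p1 + q1); first exact: ideal_spanD.
  by exists (p2 + q2); [exact: ideal_spanD|rewrite addrACA].
have cM G' z : ideal_span (semigroup_algebra K H) G' z ->
    ideal_span (semigroup_algebra K H) G' (c%:MP * z).
  by apply: ideal_span_mull => // y z'; exact: semigroup_algebraM.
have xbX h' : H h' -> monomial_ideal K H b 'X_[h' + b].
  by move=> Hh'; rewrite monomial_idealE //; apply: supportedX; exists h'.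
case: (split_off_rays DL bL Glarge hk) => [[h' Hh' ->]|[u [s [sG sL ks ->]]]].
  exists 0; first exact: ideal_span0.
  by exists (c%:MP * 'X_[h' + b]); [apply/cM/xbX|rewrite add0r].
have uL : (d * L <= size u)%N by move: ks; rewrite /k; lia.
(* The even distribution: [L] copies of every ray, with the surplus put on the first one so that [v]
   has as many rays as [u]. *)
have [v cv sv] := exists_seq_count
  (fun j : 'I_d => L + (j == Ordinal d0) * (size u - d * L))%N.
have {}sv : size u = size v.
  rewrite sv big_split /= sum_nat_const card_ord (bigD1 (Ordinal d0)) //= ?eqxx ?mul1n.
  by rewrite big1 ?addn0 ?subnKC // => j /negbTE->.
set su := (\sum_(i <- u) a i + _)%MM.
pose sv' := (\sum_(i <- v) a i + \sum_(x <- s) x)%MM.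
have Hs : H (\sum_(x <- s) x)%MM by apply: submonoid_sum => x /sG/generator_mem.
(* [L] copies of a_j contribute D L to the j-th coordinate, which is at least e_j(b). *)
have [h' Hh' svE] : exists2 h', H h' & sv' = (h' + b)%MM.
  apply: (coordsB coords) => // [|j]; first by apply: H_monoid.2 => //; exact: ray_sum_mem.
  rewrite eD // ?coords_ray_sum ?cv; last exact: ray_sum_mem.
  by have := leq_pmull L D0; have := bL j; nia.
(* The difference lies in J m^k by exchanging rays, and the redistributed monomial is a multiple of
   x^b. *)
exists (c%:MP * ('X_[su] - 'X_[sv'])).
  by apply: cM; apply: (ray_exchange K H_monoid G0 HG ray_long sv ks); exists s.
exists (c%:MP * 'X_[sv']); first by rewrite svE; apply/cM/xbX.
by rewrite -mulrDr subrK.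
Qed.

Lemma large_weight_of_reduction k c j0 : (0 < e b j0)%N ->
  ideal_add (ideal_exp (semigroup_algebra K H) m k.+1) (monomial_ideal K H b) =
    ideal_add (ideal_mul (semigroup_algebra K H) J
      (ideal_exp (semigroup_algebra K H) m k)) (monomial_ideal K H b) ->
  H c -> c != 0%MM -> e c j0 = 0%N -> (D <= \sum_j e c j)%N.
Proof.
move=> bj0 red Hc c0 cj0; set w := (\sum_j e c j)%N.
have e_sumD g h : H g -> H h -> (\sum_j e (g + h)%MM j = \sum_j e g j + \sum_j e h j)%N.
  by move=> Hg Hh; rewrite -big_split; apply: eq_bigr => j _; rewrite eD.
(* One descent step writes c + h = a_i + u with [u] on the same facet and again in m^k. Adding [c]
   gains weight [w], removing a_i loses weight [D], and weights stay nonnegative. *)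
have descend n h : long_sums G k h -> e h j0 = 0%N ->
    (n * D <= \sum_j e h j + n * w)%N.
  elim: n h => // n IH h Gh hj0.
  have Hh := long_sumsH HG Gh.
  have : ideal_add (ideal_exp (semigroup_algebra K H) m k.+1)
      (monomial_ideal K H b) 'X_[c + h].
    exists 'X_[c + h]; last by exists 0; [exact: ideal_span0|rewrite addr0].
    rewrite /m (ideal_exp_max K H_monoid G0 HG); apply: supportedX.
    by apply: (long_sumsD (long_sums1 HG Hc c0) Gh).
  rewrite red => -[x Jx [y]]; rewrite monomial_idealE // => yb xy.
  have : (c + h)%MM \in msupp (x + y) by rewrite xy msuppX mem_head.
  (* A multiple of x^b has positive coordinate [j0], whereas c + h lies on the facet; so this
     monomial must come from J m^k. *)
  move=> /msuppD_le; rewrite mem_cat => /orP[|/yb [h' Hh']]; last first.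
    by move/(congr1 (e^~ j0)); rewrite /= !eD // cj0 hj0; lia.
  move=> /(ideal_mul_support H_monoid G0 HG Jx)[i [u [Gu chE]]].
  have Hu := long_sumsH HG Gu; have Hi := coords_ray_mem coords i.
  have uj0 : e u j0 = 0%N.
    by move/(congr1 (e^~ j0)): chE; rewrite /= !eD // cj0 hj0; lia.
  have wi : (\sum_j e (a i) j = D)%N.
    rewrite (bigD1 i) //= e_ray eqxx muln1 big1 ?addn0 // => j /negbTE ji.
    by rewrite e_ray eq_sym ji muln0.
  have := IH u Gu uj0.
  have : (\sum_j e (c + h)%MM j = \sum_j e (a i + u)%MM j)%N by rewrite chE.
  by rewrite !e_sumD // wi -/w !mulSn; lia.
have Gkc : long_sums G k (\sum_(x <- nseq k c) x)%MM.
  have := long_sums_big (nseq k c) (fun=> long_sums1 HG Hc c0).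
  by rewrite !big_nseq size_nseq.
(* Starting from k c, of weight k w, [n] steps give n (D - w) <= k w; if w < D, this fails for n = k
   w + 1. *)
have := descend (k * w).+1 _ Gkc; rewrite coords_nseq // cj0 muln0 => /(_ erefl).
under eq_bigr do rewrite coords_nseq //.
rewrite -big_distrr /= -/w; case: (leqP D w) => // wD.
nia.
Qed.

End Reductions.

(** * Cones over their extremal rays *)

Lemma primitive_part (d : nat) (t : 'X_{1..d}) : t != 0%MM ->
  exists g v, [/\ (0 < g)%N, primitive v & forall i, t i = (g * v i)%N].
Proof.
move=> t0; pose g := (\big[gcdn/0]_(i < d) t i)%N.
have gt i : (g %| t i)%N by apply: (biggcdn_inf i).
have [i ti0] : exists i, t i != 0%N.
  apply: contrapT => nt; move/eqP: t0; apply; apply/mnmP => i; rewrite mnm0E.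
  by apply/eqP; apply: contrapT => /negP ti; apply: nt; exists i.
have g0 : (0 < g)%N by apply: dvdn_gt0 (gt i); rewrite lt0n.
pose v : 'X_{1..d} := [multinom (t i %/ g)%N | i < d].
have tE j : t j = (g * v j)%N by rewrite mnmE mulnC divnK.
exists g, v; split=> //; set g' := (\big[gcdn/0]_(i < d) v i)%N.
have : (g * g' %| g * 1)%N.
  rewrite muln1; apply/dvdn_biggcdP => j _; rewrite tE dvdn_mul //.
  exact: (biggcdn_inf j).
by rewrite dvdn_pmul2l // dvdn1 => /eqP.
Qed.

(** * Irredundant generators and extremal rays of finitely generated cones *)

Section Cones.
Variables (R : realType) (d : nat).
Implicit Types (A P : set 'rV[R]_d) (T : seq 'X_{1..d}) (h t : 'X_{1..d}).

Notation rv := (@nat_to_real_vec R d).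

Lemma nat_to_real_vecE h i : rv h 0 i = (h i)%:R.
Proof. by rewrite !mxE. Qed.

Lemma nat_to_real_vec0 : rv 0%MM = 0.
Proof. by apply/rowP => i; rewrite nat_to_real_vecE mnm0E [RHS]mxE. Qed.

Lemma nat_to_real_vecD g h : rv (g + h)%MM = rv g + rv h.
Proof. by apply/rowP => i; rewrite [RHS]mxE !nat_to_real_vecE mnmDE natrD. Qed.

Lemma nat_to_int_vec_inj : injective (@nat_to_int_vec d).
Proof. by move=> g h gh; apply/mnmP => i; have /rowP/(_ i) := gh; rewrite !mxE => -[]. Qed.

Lemma cone_subset A P : P 0 -> (forall x y, P x -> P y -> P (x + y)) ->
  (forall l x, 0 <= l -> A x -> P (l *: x)) -> cone A `<=` P.
Proof.
move=> P0 PD PZ _ [s [sA ->]]; rewrite big_seq; apply: (big_ind P) => // p /sA[].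
exact: PZ.
Qed.

Lemma cone0 A : cone A 0.
Proof. by exists [::]; split=> //; rewrite big_nil. Qed.

Lemma coneD A x y : cone A x -> cone A y -> cone A (x + y).
Proof.
move=> [s [sA ->]] [t [tA ->]]; exists (s ++ t); split; last by rewrite big_cat.
by move=> p; rewrite mem_cat => /orP[/sA|/tA].
Qed.

Lemma coneZ A l x : 0 <= l -> cone A x -> cone A (l *: x).
Proof.
move=> l0 [s [sA ->]]; exists [seq (l * p.1, p.2) | p <- s]; split.
  by move=> _ /mapP[p /sA[p0 Ap] ->] /=; rewrite mulr_ge0.
by rewrite big_map scaler_sumr; apply: eq_bigr => p _; rewrite scalerA.
Qed.

Lemma cone_gen A x : A x -> cone A x.
Proof.
move=> Ax; exists [:: (1, x)]; split; last by rewrite big_seq1 scale1r.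
by move=> p; rewrite inE => /eqP->; rewrite ler01.
Qed.

Notation seq_cone T := (cone (rv @` [set` T])).

Lemma seq_cone_rem T t x : t \in T -> seq_cone T x ->
  exists2 l, 0 <= l & exists2 y, seq_cone (rem t T) y & x = l *: rv t + y.
Proof.
move=> tT; move: x; apply: (@cone_subset _ [set x | exists2 l, 0 <= l &
  exists2 y, seq_cone (rem t T) y & x = l *: rv t + y]) => [|x y|l _ l0 [u /= uT <-]].
- by exists 0 => //; exists 0; rewrite ?scale0r ?addr0 //; exact: cone0.
- move=> [l l0 [x' Tx' ->]] [k k0 [y' Ty' ->]].
  exists (l + k); first exact: addr_ge0.
  by exists (x' + y'); [exact: coneD|rewrite [in RHS]scalerDl addrACA].
- have [->|ut] := eqVneq u t.
    by exists l => //; exists 0; rewrite ?addr0 //; exact: cone0.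
  exists 0 => //; exists (l *: rv u); last by rewrite [in RHS]scale0r add0r.
  apply: coneZ => //; apply: cone_gen; exists u => //=.
  by move: uT; rewrite (perm_mem (perm_to_rem tT)) inE (negbTE ut).
Qed.

Lemma seq_cone_ge0 T x i : seq_cone T x -> 0 <= x 0 i.
Proof.
move: x; apply: (@cone_subset _ [set x | 0 <= x 0 i]) => /= [|x y|l _ l0 [t _ <-]].
- by rewrite mxE.
- by rewrite mxE; exact: addr_ge0.
- by rewrite mxE nat_to_real_vecE mulr_ge0.
Qed.

Lemma irredundant_generators (H : set 'X_{1..d}) T :
  {in T, forall t, H t} -> (forall h, H h -> seq_cone T (rv h)) ->
  exists T', [/\ {in T', forall t, H t}, forall h, H h -> seq_cone T' (rv h)
    & {in T', forall t, ~ seq_cone (rem t T') (rv t)}].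
Proof.
have [n] := ubnP (size T); elim: n T => // n IH T Tn TH HT.
have [[t tT tc]|nt] := pselect (exists2 t, t \in T & seq_cone (rem t T) (rv t)); last first.
  by exists T; split=> // t tT tc; apply: nt; exists t.
apply: (IH (rem t T)) => [|u /mem_rem/TH //|h /HT].
  by rewrite size_rem //; case: (T) tT Tn.
move=> /(seq_cone_rem tT)[l l0 [y yT ->]].
by apply: coneD => //; apply: coneZ.
Qed.

(* In the nonnegative orthant a sum of two cone elements is a multiple of t only
   if the parts off t vanish, since t is not generated by the others. *)
Lemma irredundant_summand T t x y l : t \in T -> ~ seq_cone (rem t T) (rv t) ->
  seq_cone T x -> seq_cone T y -> x + y = l *: rv t ->
  exists2 k, 0 <= k & x = k *: rv t.
Proof.
move=> tT nt /(seq_cone_rem tT)[k k0 [x' Tx' ->]] /(seq_cone_rem tT)[k' k'0 [y' Ty' ->]].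
rewrite addrACA -scalerDl => xyE.
have {}xyE : x' + y' = (l - (k + k')) *: rv t.
  by rewrite scalerBl -xyE [_ + (x' + y')]addrC addrK.
exists k => //; suff -> : x' = 0 by rewrite addr0.
have [lk|lk] := ltP 0 (l - (k + k')).
  case: nt; rewrite -[rv t]scale1r -(mulVf (lt0r_neq0 lk)) -scalerA -xyE.
  by apply: coneZ; [rewrite invr_ge0 ltW|exact: coneD].
apply/rowP => i; rewrite [RHS]mxE; apply/eqP; rewrite eq_le (seq_cone_ge0 i Tx') andbT.
have := seq_cone_ge0 i Ty'; rewrite -(lerD2l (x' 0 i)) addr0 => /le_trans; apply.
move/rowP/(_ i): xyE; rewrite mxE => ->.
by rewrite mxE nat_to_real_vecE mulr_le0_ge0.
Qed.

(** A convex combination on the ray is a sum of two scaled cone elements, so [irredundant_summand]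
    puts each of them on the ray. *)
Lemma irredundant_extremal_ray T t : t \in T -> seq_cone T (rv t) ->
  ~ seq_cone (rem t T) (rv t) ->
  extremal_ray (seq_cone T) [set x | exists2 l, 0 <= l & x = l *: rv t].
Proof.
move=> tT Tt nt; split; last first.
  exists (rv t); last by move=> w [l _ ->]; exists l.
  split; first by exists 1; rewrite ?ler01 ?scale1r.
  by apply/eqP => t0; apply: nt; rewrite t0; exact: cone0.
have convC (x y : 'rV[R]_d) s : 0 < s < 1 -> seq_cone T x -> seq_cone T y ->
    [set x | exists2 l, 0 <= l & x = l *: rv t] ((1 - s) *: x + s *: y) ->
    exists2 l, 0 <= l & x = l *: rv t.
  move=> /andP[s0 s1] Tx Ty [l _ xyE].
  have s1' : 0 < 1 - s by rewrite subr_gt0.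
  have [||k k0 xk] := irredundant_summand tT nt _ _ xyE.
  - by apply: coneZ => //; exact: ltW.
  - by apply: coneZ => //; exact: ltW.
  exists ((1 - s)^-1 * k); first by rewrite mulr_ge0 // invr_ge0 ltW.
  by rewrite -scalerA -xk scalerA mulVf ?scale1r ?lt0r_neq0.
split.
- move=> _ [l l0 ->]; exact: coneZ.
- move=> _ _ s [l l0 ->] [k k0 ->] /andP[s0 s1].
  exists ((1 - s) * l + s * k); first by rewrite addr_ge0 // mulr_ge0 // subr_ge0.
  by rewrite [RHS]scalerDl -!scalerA.
- move=> x y s Tx Ty s01 Fxy; split; first exact: convC Fxy.
  (* The other endpoint follows by symmetry, exchanging [s] with 1 - s. *)
  apply: (convC y x (1 - s)) => //; first by case/andP: s01; rewrite subr_gt0 gtrBl => -> ->.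
  by rewrite subKr addrC.
Qed.

End Cones.

(** * Coordinates with respect to the extremal rays *)

Section RayBasis.
Variables (R : realType) (d : nat) (H : set 'X_{1..d}) (a : 'I_d -> 'X_{1..d}).
Hypothesis H_ns : normal_simplicial R H.
Hypothesis Ha : extremal_rays R H a.

Notation rv := (@nat_to_real_vec R d).
Notation seq_cone T := (cone (rv @` [set` T])).
Notation C := (@real_cone d R H).

Lemma normal_simplicial_submonoid : is_submonoid H. Proof. by case: H_ns => -[]. Qed.

Lemma normal_mem z : C (int_to_real_vec R z) ->
  exists2 h, H h & nat_to_int_vec h = z.
Proof.
move=> zC; have [_ HN _] := H_ns.
by have : [set z | C (int_to_real_vec R z)] z by []; rewrite -HN.
Qed.

Lemma normal_nat_mem h : C (rv h) -> H h.
Proof. by move=> /normal_mem[g Hg /nat_to_int_vec_inj <-]. Qed.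

Lemma ray_mem i : H (a i).
Proof.
have [_ aE] := Ha; have : range a (a i) by exists i.
by rewrite aE => -[].
Qed.

Definition ray_matrix : 'M[int]_d := \matrix_i nat_to_int_vec (a i).
Let A : 'M[R]_d := map_mx intr ray_matrix.

Lemma ray_matrix_row i : row i A = rv (a i).
Proof. by apply/rowP => j; rewrite !mxE. Qed.

Lemma mulmx_rays (l : 'rV[R]_d) : l *m A = \sum_i l 0 i *: rv (a i).
Proof. by rewrite mulmx_sum_row; apply: eq_bigr => i _; rewrite ray_matrix_row. Qed.

(** In an irredundant finite generating list of the cone every member spans an extremal ray, hence
    is a positive multiple of some a_i. *)
Lemma real_cone_rays v :
  C v <-> exists2 l : 'rV[R]_d, (forall i, 0 <= l 0 i) & v = l *m A.
Proof.
split; last first.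
  move=> [l l0 ->]; rewrite mulmx_rays; apply: (big_ind (C)) => [||i _].
  - exact: cone0.
  - by move=> x y; apply: coneD.
  - by apply/coneZ => //; apply: cone_gen; exists (a i) => //; exact: ray_mem.
pose P (v : 'rV[R]_d) := exists2 l : 'rV[R]_d, (forall i, 0 <= l 0 i) & v = l *m A.
have P0 : P 0 by exists 0; rewrite ?mul0mx // => i; rewrite mxE.
have PD x y : P x -> P y -> P (x + y).
  move=> [l l0 ->] [k k0 ->]; exists (l + k); last by rewrite mulmxDl.
  by move=> i; rewrite mxE addr_ge0.
have PZ c x : 0 <= c -> P x -> P (c *: x).
  move=> c0 [l l0 ->]; exists (c *: l); last by rewrite scalemxAl.
  by move=> i; rewrite mxE mulr_ge0.
have [[_ [S /finite_seqP[S' ->] SH] _] _ _] := H_ns.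
have S'H : {in S', forall t, H t}.
  by move=> t tS; rewrite -SH; apply: sub_gen_smallest.
have HS' h : H h -> seq_cone S' (rv h).
  rewrite -SH; move: h; apply: smallest_sub; last by move=> t tS; by apply: cone_gen; exists t.
  split; first by rewrite /= nat_to_real_vec0; exact: cone0.
  by move=> g h Sg Sh; rewrite /= nat_to_real_vecD; exact: coneD.
have [T [TH HT nT]] := irredundant_generators S'H HS'.
have CT : C = seq_cone T.
  apply/seteqP; split.
    apply: cone_subset; [exact: cone0|exact: coneD|].
    by move=> l _ l0 [h Hh <-]; apply: coneZ => //; exact: HT.
  apply: cone_subset; [exact: cone0|by move=> ? ?; exact: coneD|].
  by move=> l _ l0 [t tT <-]; apply: coneZ => //; apply: cone_gen; exists t => //; exact: TH.
rewrite CT; move: v; apply: (@cone_subset _ _ _ P) => // l _ l0 [t tT <-]; apply: (PZ) => //.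
have ray_t := irredundant_extremal_ray tT (HT _ (TH _ tT)) (nT _ tT).
have t0 : t != 0%MM.
  by apply/eqP => t0; apply: (nT _ tT); rewrite t0 nat_to_real_vec0; exact: cone0.
have [g [w [g0 wprim tgw]]] := primitive_part t0.
have rtw : rv t = g%:R *: rv w.
  by apply/rowP => i; rewrite [RHS]mxE !nat_to_real_vecE tgw natrM.
have rwt : rv w = g%:R^-1 *: rv t.
  by rewrite rtw scalerA mulVf ?scale1r // pnatr_eq0 -lt0n.
have g0' : 0 <= g%:R^-1 :> R by rewrite invr_ge0.
(* Normality puts the primitive vector [w] into [H], which identifies it as one of the a_i. *)
have [i _ aiw] : range a w.
  have [_ ->] := Ha; split => //.
    apply: normal_nat_mem; rewrite CT rwt; apply: coneZ => //.
    exact: HT (TH _ tT).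
  by eexists; [rewrite CT; exact: ray_t|exists g%:R^-1].
rewrite rtw -aiw; apply: PZ => //; exists (delta_mx 0 i).
  by move=> j; rewrite mxE; case: (_ && _).
by rewrite -rowE ray_matrix_row.
Qed.

(** The integer vectors in the real row space of [A] form a subgroup containing [H], hence all of
    Z^d; in particular the unit vectors lie in the row space. *)
Lemma ray_matrix_unit : A \in unitmx.
Proof.
have [[_ _ gen] _ _] := H_ns.
rewrite -row_full_unit -sub1mx; apply/row_subP => i.
pose G : set 'rV[int]_d := [set z | (int_to_real_vec R z <= A)%MS].
have GT : [set: 'rV[int]_d] `<=` G.
  rewrite -gen; apply: smallest_sub.
    split=> [|x y Gx Gy]; rewrite /G /=.
      by rewrite /int_to_real_vec map_mx0 sub0mx.
    by rewrite /int_to_real_vec map_mxB addmx_sub // eqmx_opp.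
  move=> _ [h Hh <-]; rewrite /G /=.
  have [l _ hl] : exists2 l : 'rV[R]_d, (forall i, 0 <= l 0 i) & rv h = l *m A.
    by apply/real_cone_rays/cone_gen; exists h.
  by rewrite -/(rv h) hl submxMl.
have /GT : [set: 'rV[int]_d] (delta_mx 0 i) by [].
by rewrite /G /= /int_to_real_vec map_delta_mx rowE mulmx1.
Qed.

Definition bary (v : 'rV[R]_d) : 'rV[R]_d := v *m invmx A.

Lemma baryK v : bary v *m A = v.
Proof. by rewrite /bary mulmxKV // ray_matrix_unit. Qed.

Lemma bary_mulmx l : bary (l *m A) = l.
Proof. by rewrite /bary mulmxK // ray_matrix_unit. Qed.

Lemma real_cone_bary v : C v <-> forall j, 0 <= bary v 0 j.
Proof.
split=> [/real_cone_rays[l l0 ->]|b0]; first by rewrite bary_mulmx.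
by apply/real_cone_rays; exists (bary v); rewrite ?baryK.
Qed.

(** [coord] computes coefficients reliably only for a free family, so the independence of the rays
    is derived first from the invertibility of [A]. *)
Lemma ray_coordE j z : ray_coord R a j z = bary (int_to_real_vec R z) 0 j.
Proof.
rewrite /ray_coord; set X := [tuple _ | i < d].
have XE (i : 'I_d) : X`_i = rv (a i) by rewrite -tnth_nth tnth_mktuple.
have sumX (k : 'I_d -> R) : \sum_(i < d) k i *: X`_i = (\row_i k i) *m A.
  by rewrite mulmx_rays; apply: eq_bigr => i _; rewrite XE mxE.
have freeX : free X.
  apply/freeP => k; rewrite sumX => kA0 i.
  have := bary_mulmx (\row_i k i); rewrite kA0 /bary mul0mx => /rowP/(_ i).
  by rewrite !mxE.
rewrite -{1}[int_to_real_vec R z]baryK mulmx_rays.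
under eq_bigr do rewrite -XE.
exact: coord_sum_free.
Qed.

(** The rays span R^d and the origin, a point of the cone, absorbs the missing weight. Hence the
    relative interior is the ordinary interior. *)
Lemma affine_hull_real_cone v : affine_hull (C) v.
Proof.
exists ((1 - \sum_i bary v 0 i, 0) :: [seq (bary v 0 i, rv (a i)) | i <- enum 'I_d]).
split.
- move=> p; rewrite inE => /orP[/eqP->|/mapP[i _ ->]] /=; first exact: cone0.
  by apply: cone_gen; exists (a i) => //; exact: ray_mem.
- by rewrite big_cons big_map big_enum /= subrK.
- by rewrite big_cons big_map big_enum /= scaler0 add0r -mulmx_rays baryK.
Qed.

Lemma omega_bary z : omega R H z <-> forall j, 0 < bary (int_to_real_vec R z) 0 j.
Proof.
set v := int_to_real_vec R z; rewrite /omega /relint /=; split.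
  move=> [_ [e e0 ev]] j.
  (* [M] exceeds every entry of a_j, so a shift by -(e/M) a_j stays within distance [e] and hence in
     the cone; the j-th coordinate is therefore at least e/M. *)
  pose M := 1 + \sum_i `|rv (a j) 0 i|.
  have M0 : 0 < M by rewrite ltr_pwDl // sumr_ge0.
  have eM : 0 < e / M by rewrite divr_gt0.
  have /real_cone_bary/(_ j) : C (v - (e / M) *: rv (a j)).
    apply: ev => [|i]; first exact: affine_hull_real_cone.
    have subE (u w : 'rV[R]_d) : (u - w) 0 i - u 0 i = - w 0 i.
      by rewrite !mxE addrAC subrr add0r.
    have scaleE c (w : 'rV[R]_d) : (c *: w) 0 i = c * w 0 i by rewrite mxE.
    rewrite subE normrN scaleE normrM gtr0_norm // mulrAC ltr_pdivrMr // ltr_pM2l //.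
    rewrite /M (bigD1 i) //= addrCA ltrDl ltr_pwDl // sumr_ge0 //.
  rewrite /bary mulmxBl -scalemxAl -ray_matrix_row rowE -mulmxA.
  rewrite mulmxV ?ray_matrix_unit // mulmx1 !mxE !eqxx mulr1 subr_ge0.
  exact: lt_le_trans.
move=> v0; split; first by apply/real_cone_bary => j; exact: ltW.
(* Conversely, [M] is a Lipschitz constant for every coordinate function in the maximum norm, so
   points within mu/M have coordinates changed by at most the smallest coordinate [mu] of [v]
   (capped at 1). *)
pose M := 1 + \sum_i \sum_j `|invmx A i j|.
have M0 : 0 < M by rewrite ltr_pwDl // sumr_ge0 // => i _; rewrite sumr_ge0.
pose mu := \big[Num.min/1]_j bary v 0 j.
have mu0 : 0 < mu by apply: (big_ind (fun x => 0 < x)) => // x y x0 y0; rewrite lt_min x0.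
exists (mu / M); first by rewrite divr_gt0.
move=> y _ yv; apply/real_cone_bary => j.
have muj : mu <= bary v 0 j by exact: bigmin_le_cond.
suff : `|bary y 0 j - bary v 0 j| <= mu.
  rewrite ler_norml => /andP[+ _]; rewrite lerBrDr => /(le_trans _); apply.
  by rewrite addrC subr_ge0.
have -> : bary y 0 j - bary v 0 j = \sum_i (y 0 i - v 0 i) * invmx A i j.
  by rewrite /bary !mxE -sumrB; apply: eq_bigr => i _; rewrite mulrBl.
apply: le_trans (ler_norm_sum _ _ _) _.
apply: (@le_trans _ _ (\sum_i mu / M * `|invmx A i j|)).
  by apply: ler_sum => i _; rewrite normrM ler_wpM2r // ltW // yv.
rewrite -mulr_sumr mulrAC ler_pdivrMr // ler_pM2l // /M.
rewrite -[leLHS]add0r lerD //; apply: ler_sum => i _.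
by rewrite (bigD1 j) //= lerDl sumr_ge0.
Qed.

Definition ray_denom : nat := `|\det ray_matrix|%N.

(** The adjugate yields the determinant times the coordinates. These are nonnegative on [H], so
    there the absolute value only removes the sign of the determinant. *)
Definition scaled_bary (h : 'X_{1..d}) (j : 'I_d) : nat :=
  `|(nat_to_int_vec h *m \adj ray_matrix) ord0 j|%N.

(* Cramer's rule: (det A) *: (v *m invmx A) = v *m \adj A is integral. *)
Lemma scaled_baryE h j : H h -> (scaled_bary h j)%:R = ray_denom%:R * bary (rv h) 0 j.
Proof.
move=> Hh; have bh0 : 0 <= bary (rv h) 0 j.
  by have /real_cone_bary : C (rv h) by apply: cone_gen; exists h.
have adjE : rv h *m \adj A = \det A *: bary (rv h).
  by rewrite -{1}[rv h]baryK -mulmxA mul_mx_adj mul_mx_scalar.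
rewrite /scaled_bary /ray_denom !natr_absz !intr_norm -det_map_mx.
rewrite -[X in _ * X](ger0_norm bh0) -normrM.
have -> : \det A * bary (rv h) 0 j = (\det A *: bary (rv h)) 0 j by rewrite [RHS]mxE.
rewrite -adjE -map_mx_adj -(map_mxM (intr : int -> R)).
by rewrite [in RHS]mxE.
Qed.

Lemma ray_denom_gt0 : (0 < ray_denom)%N.
Proof.
rewrite absz_gt0; apply/eqP => det0; have := ray_matrix_unit.
by rewrite unitmxE det_map_mx det0 unitr0.
Qed.

Lemma rays_scaled_coords : scaled_coords H a ray_denom scaled_bary.
Proof.
have D0 : 0 < ray_denom%:R :> R by rewrite ltr0n ray_denom_gt0.
split; [exact: ray_mem|exact: ray_denom_gt0| | |].
- move=> g h j Hg Hh; apply/eqP; rewrite -(eqr_nat R) natrD !scaled_baryE //; last first.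
    by apply: normal_simplicial_submonoid.2.
  have addE (u w : 'rV[R]_d) : (u + w) 0 j = u 0 j + w 0 j by rewrite mxE.
  by rewrite -mulrDr nat_to_real_vecD /bary mulmxDl addE.
- move=> i j; apply/eqP; rewrite -(eqr_nat R) natrM scaled_baryE; last exact: ray_mem.
  by rewrite -ray_matrix_row rowE bary_mulmx mxE eqxx /= [j == i]eq_sym.
- move=> g h Hg Hh gh.
  (* The difference h - g has nonnegative coordinates, so it is a lattice point of the cone, and
     normality applies. *)
  have [|h' Hh' hE] := @normal_mem (nat_to_int_vec h - nat_to_int_vec g).
    apply/real_cone_bary => j; rewrite /int_to_real_vec map_mxB /bary mulmxBl.
    have subE (u w : 'rV[R]_d) : (u - w) 0 j = u 0 j - w 0 j by rewrite !mxE.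
    rewrite subE subr_ge0 -(ler_pM2l D0).
    by rewrite -!scaled_baryE // ler_nat.
  exists h' => //; apply/mnmP => i; move/rowP/(_ i): hE.
  by rewrite mnmDE !mxE; lia.
Qed.

Lemma omega_scaled h : H h ->
  omega R H (nat_to_int_vec h) <-> forall j, (0 < scaled_bary h j)%N.
Proof.
have D0 : 0 < ray_denom%:R :> R by rewrite ltr0n ray_denom_gt0.
move=> Hh; rewrite omega_bary; split=> h0 j; have := h0 j.
  by rewrite -(ltr0n R) scaled_baryE // pmulr_rgt0.
by rewrite -(ltr0n R) scaled_baryE // pmulr_rgt0.
Qed.

Lemma ray_coord_sum_ge1 h : H h ->
  1 <= \sum_(j < d) ray_coord R a j (nat_to_int_vec h) <->
  (ray_denom <= \sum_(j < d) scaled_bary h j)%N.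
Proof.
have D0 : 0 < ray_denom%:R :> R by rewrite ltr0n ray_denom_gt0.
move=> Hh; rewrite -(ler_nat R) natr_sum.
under [X in _ <-> is_true (_ <= X)]eq_bigr do rewrite scaled_baryE //.
rewrite -mulr_sumr -{1}[ray_denom%:R]mulr1 ler_pM2l //.
by under eq_bigr do rewrite ray_coordE.
Qed.

End RayBasis.

(** * Generating sets *)

(** Zero is filtered out because the number of summands is to measure membership in powers of the
    maximal ideal. *)
Lemma generates_long_sums (d : nat) (H : set 'X_{1..d}) (s : seq 'X_{1..d}) :
  is_submonoid H -> generates [set` s] H ->
  H = long_sums [seq x <- s | x != 0%MM] 0.
Proof.
move=> H_monoid gen; apply/seteqP; split; last first.
  move=> _ [t [tG _ ->]]; rewrite big_seq.
  apply: big_ind => [||x /tG]; [exact: H_monoid.1|exact: H_monoid.2|].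
  by rewrite mem_filter => /andP[_ xs]; rewrite -gen; apply: sub_gen_smallest.
rewrite -gen; apply: smallest_sub.
  split; first by exists [::]; split=> //; rewrite big_nil.
  by move=> m n; apply: long_sumsD.
move=> x xs; have [->|x0] := eqVneq x 0%MM.
  by exists [::]; split=> //; rewrite big_nil.
exists [:: x]; split=> //; last by rewrite big_seq1.
by move=> y; rewrite inE mem_filter => /eqP->; rewrite x0.
Qed.

Lemma smallest_submonoid (d : nat) (S : set 'X_{1..d}) :
  is_submonoid (smallest (@is_submonoid d) S).
Proof.
split=> [A [[A0 _] _] //|m n Sm Sn A [AM SA]].
by apply: AM.2; [apply: Sm|apply: Sn].
Qed.

(** Every submonoid contains 0 anyway, so a generating set without 0 generates the same
    submonoid. *)
Lemma minimal_generating_set_neq0 (d : nat) (H BH : set 'X_{1..d}) c :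
  minimal_generating_set H BH -> BH c -> c != 0%MM.
Proof.
move=> [gen min] Bc; apply/eqP => c0; rewrite {}c0 in Bc.
have : BH `\ 0%MM = BH.
  apply: min; first by move=> x [].
  rewrite /generates -gen; apply/seteqP; split.
    by apply: sub_smallest2r; [exact: smallest_submonoid|move=> x []].
  apply: smallest_sub; first exact: smallest_submonoid.
  move=> x Bx; have [->|x0] := pselect (x = 0%MM); first exact: (smallest_submonoid _).1.
  by apply: sub_gen_smallest.
by move=> BE; move: Bc; rewrite -BE => -[_]; apply.
Qed.

(** * The equivalence, passing between the Hilbert basis and a finite generating list *)

Theorem theorem2p4 (R : realType) (d : nat) (K : fieldType)
    (H : set 'X_{1..d}) (a : 'I_d -> 'X_{1..d}) (BH : set 'X_{1..d})
    (b : 'X_{1..d}) :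
  (2 <= d)%N ->
  normal_simplicial R H ->
  extremal_rays R H a ->
  minimal_generating_set H BH ->
  b != 0%MM ->
  omega R H (nat_to_int_vec b) ->
  let KH := semigroup_algebra K H in
  let m := max_ideal K H in
  let J := ray_difference_ideal K H a in
  let xbR := monomial_ideal K H b in
  (exists k : nat,
     ideal_add (ideal_exp KH m k.+1) xbR =
     ideal_add (ideal_mul KH J (ideal_exp KH m k)) xbR)
  <->
  (forall c : 'X_{1..d}, BH c -> ~ omega R H (nat_to_int_vec c) ->
     1 <= \sum_(j < d) ray_coord R a j (nat_to_int_vec c)).
Proof.
move=> d2 H_ns Ha BH_min _ b_omega KH m J xbR.
have H_monoid := normal_simplicial_submonoid H_ns; have coords := rays_scaled_coords H_ns Ha.
have [[_ [_ /finite_seqP[s ->] /(generates_long_sums H_monoid) HG] _] _ _] := H_ns.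
set G := [seq x <- s | x != 0%MM] in HG.
have G0 : 0%MM \notin G by rewrite mem_filter eqxx.
have BH_H c : BH c -> H c.
  by case: BH_min => <- _ Bc; apply: sub_gen_smallest.
have Hb : H b by apply: (normal_nat_mem H_ns); case: b_omega.
have b_gt0 := (omega_scaled H_ns Ha Hb).1 b_omega.
split=> [[k red] c Bc c_omega|B_large].
  have Hc := BH_H c Bc; apply/(ray_coord_sum_ge1 H_ns Ha Hc).
  (* An element of [H] that is not interior lies on some facet. *)
  have [j0 cj0] : exists j0, scaled_bary a c j0 = 0%N.
    apply: contrapT => nc; apply: c_omega; apply/(omega_scaled H_ns Ha Hc) => j.
    by rewrite lt0n; apply/eqP => cj; apply: nc; exists j.
  exact: (large_weight_of_reduction H_monoid G0 HG coords Hb (b_gt0 j0) red Hc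
    (minimal_generating_set_neq0 BH_min Bc) cj0).
apply: (reduction_of_large_weights K H_monoid G0 HG coords Hb) => [|c cG].
  exact: leq_trans d2.
(* Condition (ii) concerns [BH], while the reduction needs the alternative on [G]. It passes to all
   nonzero elements of [H], since adding an element of [H] lowers no coordinate. *)
pose large h := (forall j, (0 < scaled_bary a h j)%N) \/
  (ray_denom a <= \sum_j scaled_bary a h j)%N.
suff {c cG} large_H : H `<=` [set h | H h /\ (h = 0%MM \/ large h)].
  have Hc : H c by apply: (generator_mem HG).
  have [_ [c0|]] := large_H c Hc; last by [].
  by move: cG; rewrite c0 (negbTE G0).
have BH_gen : smallest (@is_submonoid d) BH = H by case: BH_min.
rewrite -{1}BH_gen; apply: smallest_sub; last first.
  move=> h Bh; have Hh := BH_H h Bh; split=> //; right.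
  have [/(omega_scaled H_ns Ha Hh)|h_omega] := pselect (omega R H (nat_to_int_vec h)).
    by left.
  by right; apply/(ray_coord_sum_ge1 H_ns Ha Hh)/B_large.
split; first by split; [exact: H_monoid.1|left].
move=> g h [Hg g_large] [Hh h_large]; split; first exact: H_monoid.2.
have eD j := coordsD coords j Hg Hh.
have sumD : (\sum_j scaled_bary a (g + h)%MM j =
    \sum_j scaled_bary a g j + \sum_j scaled_bary a h j)%N.
  by rewrite -big_split; apply: eq_bigr.
case: g_large => [->|g_large]; first by rewrite add0m.
case: h_large => [->|_]; first by rewrite addm0; right.
right; case: g_large => [g0|gD]; [left=> j|right].
  by rewrite eD ltn_addr.
by rewrite sumD (leq_trans gD) // leq_addr.
Qed.
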